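(* The FIFO Stack-Up problem can be solved in time $O(n^2\cdot (m+2)^k)$.
   Context: FIFO Stack-Up problem. An instance consists of a list $Q=(q_1,\ldots,q_k)$ of $k$ sequences of pairwise distinct bins, a pallet symbol ${\it plt}(b)$ (a positive integer) for every bin $b$, and a positive integer $p$. Standing assumption: every pallet symbol that occurs is carried by at least two bins. $n$ is the total number of bins and $m$ the number of distinct pallet symbols (pallets). A configuration is a tuple $(i_1,\ldots,i_k)$ with $0\le i_j\le |q_j|$, meaning that the first $i_j$ bins of $q_j$ have been removed. A pallet $t$ is open in configuration $(i_1,\ldots,i_k)$ if there are indices $j,\ell$ such that some bin for $t$ is at a position $\le i_j$ in $q_j$ and some bin for $t$ is at a position $> i_\ell$ in $q_\ell$. A transformation step removes the bin at position $i_j+1$ of some sequence $q_j$ (with $i_j<|q_j|$). A processing of $Q$ is a sequence of transformation steps from $(0,\ldots,0)$ to $(|q_1|,\ldots,|q_k|)$. The question is whether there is a processing of $Q$ such that in each configuration during the processing at most $p$ pallets are open. *)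

(* Defs.v *)
From mathcomp Require Import all_boot.

Set Implicit Arguments.
Unset Strict Implicit.
Unset Printing Implicit Defensive.

Section FifoStackUp.

Variables (B : eqType) (k : nat) (plt : B -> nat) (Q : k.-tuple (seq B)).

Definition bins : seq B := flatten Q.

Definition pallets : seq nat := undup [seq plt b | b <- bins].

Definition num_bins : nat := size bins.

Definition num_pallets : nat := size pallets.

Definition valid_instance (p : nat) : Prop :=
  [/\ uniq bins,
      {in bins, forall b, 0 < plt b},
      {in pallets, forall t, 2 <= count (fun b => plt b == t) bins}
    & 0 < p].

(* tnth c j is the number of bins already removed from the sequence tnth Q j;
   the constraint tnth c j <= size (tnth Q j) is preserved by [step]. *)
Definition config := k.-tuple nat.

Definition initial : config := [tuple 0 | j < k].

Definition final : config := [tuple size (tnth Q j) | j < k].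

Definition is_open (c : config) (t : nat) : bool :=
  [exists j, exists l,
     has (fun b => plt b == t) (take (tnth c j) (tnth Q j)) &&
     has (fun b => plt b == t) (drop (tnth c l) (tnth Q l))].

Definition num_open (c : config) : nat := count (is_open c) pallets.

Definition step (c c' : config) : bool :=
  [exists j, (tnth c j < size (tnth Q j)) &&
             (c' == [tuple tnth c l + (l == j) | l < k])].

(* s lists the configurations reached after the initial one. *)
Definition processing (s : seq config) : bool :=
  path step initial s && (last initial s == final).

Definition fifo_stackup (p : nat) : Prop :=
  exists2 s : seq config,
    processing s & all (fun c => num_open c <= p) (initial :: s).

(* Bins are distinct, so a bin is given to the algorithm by its place in the
   list together with its pallet symbol. *)
Definition encode (p : nat) : seq nat :=
  [:: k, p & flatten [seq size q :: [seq plt b | b <- q] | q <- Q]].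

End FifoStackUp.

(* Unit-cost random access machine on natural numbers, with structured control
   flow.  The only arithmetic is addition and truncated subtraction: with
   multiplication the unit-cost measure would not be realistic.  Every node of
   an expression and every executed instruction or test costs one time unit. *)
Inductive expr : Type :=
| Const of nat
| Reg of nat
| Read of expr
| Add of expr & expr
| Sub of expr & expr.

Inductive cmd : Type :=
| Skip
| Set_reg of nat & expr
| Store of expr & expr
| Seq of cmd & cmd
| If of expr & cmd & cmd
| While of expr & cmd.

Record state : Type := State { regs : nat -> nat; mem : nat -> nat }.

Definition update (f : nat -> nat) (a v : nat) : nat -> nat :=
  fun x => if x == a then v else f x.

Fixpoint eval (s : state) (e : expr) : nat :=
  match e with
  | Const v => v
  | Reg r => regs s r
  | Read e1 => mem s (eval s e1)
  | Add e1 e2 => eval s e1 + eval s e2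
  | Sub e1 e2 => eval s e1 - eval s e2
  end.

Fixpoint ecost (e : expr) : nat :=
  match e with
  | Const _ | Reg _ => 1
  | Read e1 => (ecost e1).+1
  | Add e1 e2 | Sub e1 e2 => (ecost e1 + ecost e2).+1
  end.

(* exec c s t s': started in state s, the command c halts in state s' after
   exactly t time units.  A guard counts as true when it is nonzero. *)
Inductive exec : cmd -> state -> nat -> state -> Prop :=
| exec_Skip s : exec Skip s 1 s
| exec_Set_reg r e s :
    exec (Set_reg r e) s (ecost e).+1
         (State (update (regs s) r (eval s e)) (mem s))
| exec_Store a e s :
    exec (Store a e) s (ecost a + ecost e).+1
         (State (regs s) (update (mem s) (eval s a) (eval s e)))
| exec_Seq c1 c2 s s1 s2 t1 t2 :
    exec c1 s t1 s1 -> exec c2 s1 t2 s2 -> exec (Seq c1 c2) s (t1 + t2) s2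
| exec_If_true e c1 c2 s s1 t :
    eval s e != 0 -> exec c1 s t s1 ->
    exec (If e c1 c2) s ((ecost e).+1 + t) s1
| exec_If_false e c1 c2 s s1 t :
    eval s e = 0 -> exec c2 s t s1 ->
    exec (If e c1 c2) s ((ecost e).+1 + t) s1
| exec_While_true e c s s1 s2 t1 t2 :
    eval s e != 0 -> exec c s t1 s1 -> exec (While e c) s1 t2 s2 ->
    exec (While e c) s ((ecost e).+1 + t1 + t2) s2
| exec_While_false e c s :
    eval s e = 0 -> exec (While e c) s (ecost e).+1 s.

Lemma exec_det c s t1 s1 t2 s2 :
  exec c s t1 s1 -> exec c s t2 s2 -> t1 = t2 /\ s1 = s2.
Proof.
move=> H; elim: H t2 s2 => {c s t1 s1} *;
  match goal with H : exec _ _ ?t ?s |- _ = ?t /\ _ = ?s => inversion H end;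
  subst => //;
  repeat match goal with H : is_true (_ != 0) |- _ => move/eqP in H end => //;
  repeat match goal with
  | IH : forall t2 s2, exec ?c ?s t2 s2 -> _, H : exec ?c ?s _ _ |- _ =>
      case: (IH _ _ H) => ? ?; subst; clear H
  end => //.
Qed.

(* The input occupies the first memory cells; everything else is zero. *)
Definition load_input (x : seq nat) : state :=
  State (fun _ => 0) (fun a => nth 0 x a).

Definition accepting (s : state) : Prop := regs s 0 != 0.

(* Main.v *)
Require Import Defs.
From mathcomp Require Import all_boot.
From mathcomp Require Import zify.
From Stdlib Require Import FunctionalExtensionality.

(* Call a configuration a decision configuration when no bin at the front of a
   sequence belongs to a pallet that has already been started.  Removing a bin
   of a started pallet never opens a pallet, so a processing may be assumed to
   do so eagerly, and only decision configurations need to be explored: from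
   one of them remove a front bin y, which opens one new pallet, then sweep once
   through all sequences removing every front bin whose pallet is started.  The
   front bin of a sequence in a decision configuration is the first of its
   pallet in that sequence, so each sequence allows at most m + 1 positions and
   there are at most (m + 1) ^ k decision configurations.  A breadth-first
   search spends O((n + k) ^ 2) on each of them.  If e sequences are empty,
   then k <= n + e, while the empty sequences contribute a factor 1 instead of
   m + 2 >= 3 to the count; this gains 3 ^ e, which absorbs (1 + e) ^ 2.

   The machine stores a configuration as a 0/1 vector over the input cells.
   Reading this vector as a binary number gives an address, and the cell there
   records whether the configuration has been reached; memory is unbounded and
   initially zero, so this takes constant time. *)

Set Implicit Arguments.
Unset Strict Implicit.
Unset Printing Implicit Defensive.

(** * Running time of commands *)

(** A weakest precondition for total correctness: [P] sees the elapsed time as well as the final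
    state, so cost and effect are proved together. *)
Definition runs (c : cmd) (s : state) (P : nat -> state -> Prop) : Prop :=
  exists t s', exec c s t s' /\ P t s'.

Lemma runs_conseq c s (P P' : nat -> state -> Prop) :
  (forall t s', P t s' -> P' t s') -> runs c s P -> runs c s P'.
Proof. by move=> PP [t [s' [cs Ps]]]; exists t, s'; split; last exact: PP. Qed.

Lemma runs_skip s (P : nat -> state -> Prop) : P 1 s -> runs Skip s P.
Proof. by move=> Ps; exists 1, s; split=> //; constructor. Qed.

Lemma runs_seq c1 c2 s (P : nat -> state -> Prop) :
  runs c1 s (fun t1 s1 => runs c2 s1 (fun t2 s2 => P (t1 + t2) s2)) ->
  runs (Seq c1 c2) s P.
Proof.
move=> [t1 [s1 [cs1 [t2 [s2 [cs2 Ps]]]]]]; exists (t1 + t2), s2.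
by split=> //; econstructor; eauto.
Qed.

Lemma runs_if e c1 c2 s (P : nat -> state -> Prop) :
  (if eval s e != 0 then runs c1 s (fun t s' => P ((ecost e).+1 + t) s')
   else runs c2 s (fun t s' => P ((ecost e).+1 + t) s')) ->
  runs (If e c1 c2) s P.
Proof.
case: eqP => /= [e0|/eqP e0] [t [s' [cs Ps]]]; exists ((ecost e).+1 + t), s'.
  by split=> //; exact: exec_If_false.
by split=> //; exact: exec_If_true.
Qed.

(** The index of [I] is a variant: a true guard forces it to be positive and the body lowers it, so
    there are at most [n] rounds. The loop may stop with the index still positive. *)
Lemma runs_while e c (I : nat -> state -> Prop) T n s :
  (forall i s, I i s -> eval s e != 0 ->
     0 < i /\ runs c s (fun t s' => t <= T /\ I i.-1 s')) ->
  I n s ->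
  runs (While e c) s (fun t s' => t <= n * (T + (ecost e).+1) + (ecost e).+1
                               /\ exists2 i, I i s' & eval s' e = 0).
Proof.
move=> Istep; elim: n s => [|n IHn] s In.
  have [/eqP e0|e1] := boolP (eval s e == 0); last by have [] := Istep _ _ In e1.
  exists (ecost e).+1, s; split; first exact: exec_While_false.
  by split; last by exists 0.
have [/eqP e0|e1] := boolP (eval s e == 0).
  exists (ecost e).+1, s; split; first exact: exec_While_false.
  by split; [rewrite leq_addl | exists n.+1].
have [_ [t1 [s1 [cs1 [t1T /= In1]]]]] := Istep _ _ In e1.
have [t2 [s2 [cs2 [t2T Is2]]]] := IHn _ In1.
exists ((ecost e).+1 + t1 + t2), s2; split; last by split=> //; lia.
exact: exec_While_true cs1 cs2.
Qed.

(** Registers are kept in a list so that reading and writing them reduces by computation. *)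
Definition St (rs : seq nat) (m : nat -> nat) : state := State (nth 0 rs) m.

Lemma runs_set r e rs m (P : nat -> state -> Prop) :
  P (ecost e).+1 (St (set_nth 0 rs r (eval (St rs m) e)) m) ->
  runs (Set_reg r e) (St rs m) P.
Proof.
move=> Ps; eexists; eexists; split; first exact: exec_Set_reg.
suff -> : update (nth 0 rs) r (eval (St rs m) e)
          = nth 0 (set_nth 0 rs r (eval (St rs m) e)) by [].
by apply: functional_extensionality => i; rewrite nth_set_nth.
Qed.

Lemma runs_store a e rs m (P : nat -> state -> Prop) :
  P (ecost a + ecost e).+1
    (St rs (update m (eval (St rs m) a) (eval (St rs m) e))) ->
  runs (Store a e) (St rs m) P.
Proof.
by move=> Ps; eexists; eexists; split; first exact: exec_Store.
Qed.

(* The cells below 3 * L hold f; above them three unbounded arrays are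
   interleaved. *)
Definition Mem (L : nat) (f A0 A1 A2 : nat -> nat) (a : nat) : nat :=
  if a < 3 * L then f a else
  (if (a - 3 * L) %% 3 is r.+1 then if r is 0 then A1 else A2 else A0)
    ((a - 3 * L) %/ 3).

(** The address [3 * (e + L) + r], with [L] in register 2, formed by additions only. *)
Definition aix (r : nat) (e : expr) : expr :=
  let d := Add e (Reg 2) in Add (Add (Add d d) d) (Const r).

Definition arr (r : nat) (e : expr) : expr := Read (aix r e).

Definition array (r : nat) (A0 A1 A2 : nat -> nat) : nat -> nat :=
  if r is r.+1 then if r is 0 then A1 else A2 else A0.

Lemma Mem_low L f A0 A1 A2 x : x < L -> Mem L f A0 A1 A2 x = f x.
Proof. by move=> xL; rewrite /Mem ifT //; lia. Qed.

Lemma eval_aix rs m r e :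
  eval (St rs m) (aix r e) = 3 * (eval (St rs m) e + nth 0 rs 2) + r.
Proof. by rewrite /aix /=; lia. Qed.

Lemma Mem_array L f A0 A1 A2 r i : r < 3 ->
  Mem L f A0 A1 A2 (3 * (i + L) + r) = array r A0 A1 A2 i.
Proof.
move=> r3; rewrite /Mem ifF; last by lia.
have -> : 3 * (i + L) + r - 3 * L = i * 3 + r by lia.
rewrite modnMDl divnMDl // modn_small // divn_small // addn0.
by case: r r3 => [|[|[|]]].
Qed.

Lemma update_Mem L f A0 A1 A2 r i v : r < 3 ->
  update (Mem L f A0 A1 A2) (3 * (i + L) + r) v =
  Mem L f (if r is 0 then update A0 i v else A0)
          (if r is 1 then update A1 i v else A1)
          (if r is 2 then update A2 i v else A2).
Proof.
move=> r3; apply: functional_extensionality => a; rewrite /update.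
have [aL|aL] := ltnP a (3 * L).
  by rewrite ifF; [rewrite /Mem aL | lia].
have -> : a = 3 * ((a - 3 * L) %/ 3 + L) + (a - 3 * L) %% 3.
  have := divn_eq (a - 3 * L) 3; lia.
have : (a - 3 * L) %% 3 < 3 by rewrite ltn_mod.
move: (_ %/ 3) (_ %% 3) => q r' r'3; rewrite !Mem_array //.
by case: r r3 => [|[|[|//]]] _; case: r' r'3 => [|[|[|//]]] _ /=;
  case: ifP => //; try (case: ifP => //); lia.
Qed.

Definition loop (r : nat) (c : cmd) : cmd :=
  Seq (Set_reg r (Const 0))
      (While (Defs.Sub (Reg 2) (Reg r)) (Seq c (Set_reg r (Add (Reg r) (Const 1))))).

Lemma runs_loop r c L T rs m (J : nat -> seq nat -> (nat -> nat) -> Prop) :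
  (forall x rs m, J x rs m -> nth 0 rs 2 = L /\ nth 0 rs r = x) ->
  (forall x rs m, x < L -> J x rs m -> runs c (St rs m) (fun t s' =>
     t <= T /\ exists rs' m', [/\ s' = St rs' m', nth 0 rs' r = x
                                & J x.+1 (set_nth 0 rs' r x.+1) m'])) ->
  J 0 (set_nth 0 rs r 0) m ->
  runs (loop r c) (St rs m) (fun t s' => t <= L * (T + 8) + 6 /\
     exists rs' m', s' = St rs' m' /\ J L rs' m').
Proof.
move=> Jr Jstep J0; apply: runs_seq; apply: runs_set => /=.
pose I i s := exists rs m, [/\ s = St rs m, i <= L & J (L - i) rs m].
have IL : I L (St (set_nth 0 rs r 0) m).
  by exists (set_nth 0 rs r 0), m; rewrite subnn.
(* The variant is [L - x]. Increment and test cost 4 each, whence [T + 8]; the initialization and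
   the last test cost 6. *)
apply: runs_conseq (@runs_while _ _ I (T + 4) _ _ _ IL).
  move=> t s' [tT [i [rs1 [m1 [-> iL J1]]] /=]].
  have [-> ->] := Jr _ _ _ J1; move=> i0.
  split; first by move: tT => /=; lia.
  by exists rs1, m1; split=> //; have -> : L = L - i by lia.
move=> i s [rs1 [m1 [-> iL J1]]] /=; have [-> ->] := Jr _ _ _ J1.
move=> i_gt0; split; first by lia.
have iL' : L - i < L by lia.
apply: runs_seq; apply: runs_conseq (Jstep _ _ _ iL' J1).
move=> t s' [tT [rs2 [m2 [-> rx J2]]]].
apply: runs_set => /=; split; first by lia.
eexists; eexists; split; [reflexivity| by lia|].
rewrite rx addn1; suff -> : L - i.-1 = (L - i).+1 by [].
by lia.
Qed.

Lemma eval_sub s e e' : eval s (Defs.Sub e e') = eval s e - eval s e'.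
Proof. by []. Qed.

Lemma eval_arr L f A0 A1 A2 r e rs : nth 0 rs 2 = L -> r < 3 ->
  eval (St rs (Mem L f A0 A1 A2)) (arr r e)
  = array r A0 A1 A2 (eval (St rs (Mem L f A0 A1 A2)) e).
Proof.
move=> <- r3.
by rewrite -[LHS]/(Mem _ _ _ _ _ (eval _ (aix r e))) eval_aix Mem_array.
Qed.

Lemma runs_store_arr L f A0 A1 A2 r e e' rs (P : nat -> state -> Prop) :
  let s := St rs (Mem L f A0 A1 A2) in
  nth 0 rs 2 = L -> r < 3 ->
  P (ecost (aix r e) + ecost e').+1
    (St rs (Mem L f
      (if r is 0 then update A0 (eval s e) (eval s e') else A0)
      (if r is 1 then update A1 (eval s e) (eval s e') else A1)
      (if r is 2 then update A2 (eval s e) (eval s e') else A2))) ->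
  runs (Store (aix r e) e') s P.
Proof.
by move=> s rsL r3 Ps; apply: runs_store; rewrite eval_aix rsL update_Mem.
Qed.

(** * The program *)

(* Registers: 0 answer, 1 p, 2 input length, 3 and 4 offsets of the first
   unprocessed configuration and of the end of the queue, 5 and 6 loop
   variables, 7 one plus the number of open pallets, 8 whether all bins are
   removed, 9 code and 10 current mark of a new configuration, 11 and 12
   scratch.  Arrays: 0 the queue, 1 reached codes, 2 status of a pallet. *)
Definition head_mark : expr := arr 0 (Add (Reg 3) (Reg 5)).

(** Statuses are indexed by symbols, which may be arbitrarily large; resetting only those that occur
    in the input takes O(L) steps. *)
Definition clear : cmd := loop 5 (Store (aix 2 (Read (Reg 5))) (Const 0)).

Definition mark : cmd :=
  Seq (Set_reg 8 (Const 1))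
      (loop 5 (If head_mark (Store (aix 2 (Read (Reg 5))) (Const 2))
                            (Set_reg 8 (Const 0)))).

(** Status 2 means started and not yet counted. Counting lowers it to 1, so a pallet is counted once
    and still reads as started in [extend]. *)
Definition count_open : cmd :=
  Seq (Set_reg 7 (Const 1))
      (loop 5 (If head_mark Skip
        (If (Defs.Sub (arr 2 (Read (Reg 5))) (Const 1))
           (Seq (Store (aix 2 (Read (Reg 5))) (Const 1))
                (Set_reg 7 (Add (Reg 7) (Const 1))))
           Skip))).

(** Register 10 enters a cell with the mark of the previous cell, and a bin inherits this mark if
    its pallet is started or is that of cell [Reg 6]. The sum of the two truncated differences
    vanishes exactly for equal symbols. *)
Definition extend : cmd :=
  Seq (Set_reg 9 (Const 0)) (Seq (Set_reg 10 (Const 0))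
    (loop 5
      (Seq (If head_mark (Set_reg 10 (Const 1))
             (If (arr 2 (Read (Reg 5))) Skip
               (If (Add (Defs.Sub (Read (Reg 5)) (Read (Reg 6)))
                        (Defs.Sub (Read (Reg 6)) (Read (Reg 5))))
                   (Set_reg 10 (Const 0)) Skip)))
      (Seq (Store (aix 0 (Add (Reg 4) (Reg 5))) (Reg 10))
           (Set_reg 9 (Add (Add (Reg 9) (Reg 9)) (Reg 10))))))).

(** The row already stands past the end of the queue, so moving the end suffices; a row with a known
    code is overwritten later. *)
Definition push : cmd :=
  If (arr 1 (Reg 9)) Skip
     (Seq (Store (aix 1 (Reg 9)) (Const 1)) (Set_reg 4 (Add (Reg 4) (Reg 2)))).

(** The outer test says that fewer than [p] pallets are open. The truncated difference of
    consecutive marks is nonzero exactly at a front bin; at cell 0 both reads coincide. *)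
Definition expand : cmd :=
  If (Defs.Sub (Add (Reg 1) (Const 1)) (Reg 7))
     (loop 6
       (If (Defs.Sub (arr 0 (Add (Reg 3) (Defs.Sub (Reg 6) (Const 1))))
                     (arr 0 (Add (Reg 3) (Reg 6))))
           (Seq extend push) Skip))
     Skip.

Definition search : cmd :=
  While (Defs.Sub (Reg 4) (Reg 3))
    (Seq clear (Seq mark (Seq count_open
    (Seq (Set_reg 0 (Add (Reg 0) (Reg 8)))
    (Seq expand (Set_reg 3 (Add (Reg 3) (Reg 2)))))))).

(** * Effect and cost of the subroutines of the search *)

Section Loops.

Variables (L : nat) (sy : nat -> nat) (acc p hd tl : nat).

Lemma runs_clear x y cnt full code v k h Q V S :
  runs clear
    (St [:: acc; p; L; hd; tl; x; y; cnt; full; code; v; k; h] (Mem L sy Q V S))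
    (fun t s' => t <= L * 60 + 6 /\ exists S', [/\
       s' = St [:: acc; p; L; hd; tl; L; y; cnt; full; code; v; k; h]
               (Mem L sy Q V S')
     & forall z, z < L -> S' (sy z) = 0]).
Proof.
pose J x rs m := exists S', [/\
  rs = [:: acc; p; L; hd; tl; x; y; cnt; full; code; v; k; h],
  m = Mem L sy Q V S' & forall z, z < x -> S' (sy z) = 0].
apply: runs_conseq (@runs_loop _ _ L 50 _ _ J _ _ _).
- move=> t s' [tT [rs [m [-> [S' [-> -> S'0]]]]]]; split; first by lia.
  by exists S'.
- by move=> ? ? ? [S' [-> _ _]].
- move=> z rs m zL [S' [-> -> S'0]]; apply: runs_store_arr => //=.
  rewrite Mem_low //; split=> //; eexists; eexists; split; [reflexivity..|].
  eexists; split; [reflexivity..|].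
  move=> u uz; rewrite /update; case: eqP => // symNE; apply: S'0.
  by rewrite ltn_neqAle -ltnS uz andbT; apply/eqP => uE; rewrite uE in symNE.
- by exists S.
Qed.

Variables (M : nat -> bool) (Q : nat -> nat).
Hypothesis QM : forall x, x < L -> Q (hd + x) = M x.

Definition started t := has (fun x => M x && (sy x == t)) (iota 0 L).

Lemma iota0S n : iota 0 n.+1 = rcons (iota 0 n) n.
Proof. by rewrite -addn1 iotaD cats1. Qed.

Lemma runs_mark x y cnt full code v k h V S :
  (forall z, z < L -> S (sy z) = 0) ->
  runs mark
    (St [:: acc; p; L; hd; tl; x; y; cnt; full; code; v; k; h] (Mem L sy Q V S))
    (fun t s' => t <= L * 80 + 8 /\ exists S', [/\
       s' = St [:: acc; p; L; hd; tl; L; y; cnt; all M (iota 0 L) : nat;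
                   code; v; k; h] (Mem L sy Q V S')
     & forall z, z < L -> S' (sy z) = if started (sy z) then 2 else 0]).
Proof.
move=> S0; apply: runs_seq; apply: runs_set => /=.
pose J x rs m := exists S', [/\
  rs = [:: acc; p; L; hd; tl; x; y; cnt; all M (iota 0 x) : nat; code; v; k; h],
  m = Mem L sy Q V S' &
  forall z, z < L ->
    S' (sy z) = if has (fun u => M u && (sy u == sy z)) (iota 0 x) then 2 else 0].
apply: runs_conseq (@runs_loop _ _ L 70 _ _ J _ _ _).
- move=> t s' [tT [rs [m [-> [S' [-> -> S'E]]]]]]; split; first by lia.
  by exists S'.
- by move=> ? ? ? [S' [-> _ _]].
- move=> z rs m zL [S' [-> -> S'E]]; apply: runs_if.
  rewrite eval_arr //= QM //; case Mz: (M z) => /=.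
    apply: runs_store_arr => //=; rewrite Mem_low //.
    split=> //; eexists; eexists; split; [reflexivity..|].
    eexists; split; [|reflexivity|].
      by rewrite [iota 0 z.+1]iota0S all_rcons Mz.
    move=> u uL; rewrite [iota 0 z.+1]iota0S has_rcons Mz /update eq_sym.
    by case: eqP => //= _; apply: S'E.
  apply: runs_set => //=.
  split=> //; eexists; eexists; split; [reflexivity..|].
  eexists; split; [|reflexivity|].
    by rewrite [iota 0 z.+1]iota0S all_rcons Mz.
  by move=> u uL; rewrite [iota 0 z.+1]iota0S has_rcons Mz; apply: S'E.
- by exists S.
Qed.

Definition open_syms n :=
  [seq sy x | x <- iota 0 n & ~~ M x && started (sy x)].

Lemma size_undup_rcons (T : eqType) (s : seq T) a :
  size (undup (rcons s a)) = (a \notin s) + size (undup s).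
Proof.
have /perm_undup/perm_size -> : rcons s a =i a :: s by move=> ?; rewrite mem_rcons.
by rewrite /=; case: ifP.
Qed.

Lemma runs_count_open x y cnt full code v k h V S :
  (forall z, z < L -> S (sy z) = if started (sy z) then 2 else 0) ->
  runs count_open
    (St [:: acc; p; L; hd; tl; x; y; cnt; full; code; v; k; h] (Mem L sy Q V S))
    (fun t s' => t <= L * 150 + 8 /\ exists S', [/\
       s' = St [:: acc; p; L; hd; tl; L; y; (size (undup (open_syms L))).+1;
                   full; code; v; k; h] (Mem L sy Q V S')
     & forall z, z < L -> (S' (sy z) != 0) = started (sy z)]).
Proof.
move=> S0; apply: runs_seq; apply: runs_set => /=.
pose J x rs m := exists S', [/\
  rs = [:: acc; p; L; hd; tl; x; y; (size (undup (open_syms x))).+1;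
           full; code; v; k; h],
  m = Mem L sy Q V S' &
  forall z, z < L ->
    S' (sy z) = if started (sy z) then 1 + (sy z \notin open_syms x) else 0].
apply: runs_conseq (@runs_loop _ _ L 130 _ _ J _ _ _).
- move=> t s' [tT [rs [m [-> [S' [-> -> S'E]]]]]]; split; first by lia.
  by exists S'; split=> // z /S'E->; case: ifP.
- by move=> ? ? ? [S' [-> _ _]].
- move=> z rs m zL [S' [-> -> S'E]]; apply: runs_if.
  have openS : open_syms z.+1 =
      if ~~ M z && started (sy z) then rcons (open_syms z) (sy z) else open_syms z.
    rewrite /open_syms [iota 0 z.+1]iota0S filter_rcons.
    by case: ifP => // _; rewrite map_rcons.
  rewrite eval_arr //= QM //; case Mz: (M z) => /=.
    apply: runs_skip; split=> //; eexists; eexists; split; [reflexivity..|].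
    by exists S'; rewrite openS Mz.
  apply: runs_if; rewrite eval_sub eval_arr //= Mem_low // S'E //.
  case stz: (started (sy z)); rewrite ?stz Mz /= in openS => /=; last first.
    apply: runs_skip; split=> //; eexists; eexists; split; [reflexivity..|].
    by exists S'; rewrite openS.
  rewrite addKn; case opz: (sy z \in open_syms z) => /=.
    apply: runs_skip; split=> //; eexists; eexists; split; [reflexivity..|].
    exists S'; rewrite openS size_undup_rcons opz; split=> // u uL.
    rewrite S'E // mem_rcons inE; case: ifP => // _.
    by case: eqP => // ->; rewrite opz.
  apply: runs_seq; apply: runs_store_arr => //=; apply: runs_set => /=.
  split=> //; eexists; eexists; split; [reflexivity..|].
  rewrite Mem_low //.
  eexists; split; [|reflexivity|].
    by rewrite openS size_undup_rcons opz addn1.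
  move=> u uL; rewrite /update openS mem_rcons inE S'E //.
  by case: eqP => //= ->; rewrite stz.
- by exists S.
Qed.

(** The marks after one left-to-right sweep that removes every front bin with a symbol in [a]; a
    marked predecessor is what makes a bin a front bin. *)
Fixpoint extended (a : pred nat) (x : nat) : bool :=
  M x || (if x is x'.+1 then extended a x' && a (sy x) else false).

Fixpoint mark_code (E : nat -> bool) (n : nat) : nat :=
  if n is n'.+1 then mark_code E n' + mark_code E n' + E n' else 0.

(** The new row is written from [tl] on, beyond the row at [hd], so the marks being read stay
    intact. In the proof, [prev z] is the content of register 10 on entering cell [z]. *)
Lemma runs_extend (st : pred nat) x y cnt full code v k h V S :
  (forall z, z < L -> (S (sy z) != 0) = st (sy z)) -> hd + L <= tl -> y < L ->
  let E := extended (fun t => st t || (t == sy y)) in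
  runs extend
    (St [:: acc; p; L; hd; tl; x; y; cnt; full; code; v; k; h] (Mem L sy Q V S))
    (fun t s' => t <= L * 150 + 10 /\ exists Q' v', [/\
       s' = St [:: acc; p; L; hd; tl; L; y; cnt; full; mark_code E L; v'; k; h]
               (Mem L sy Q' V S),
       forall u, u < tl -> Q' u = Q u
     & forall z, z < L -> Q' (tl + z) = E z]).
Proof.
move=> Sst hd_tl yL E.
pose prev z : bool := if z is z'.+1 then E z' else false.
have E_prev z : E z = M z || prev z && (st (sy z) || (sy z == sy y)).
  by rewrite /prev; case: z.
apply: runs_seq; apply: runs_set => /=; apply: runs_seq; apply: runs_set => /=.
pose J z rs m := exists Q', [/\
  rs = [:: acc; p; L; hd; tl; z; y; cnt; full; mark_code E z; prev z : nat; k; h],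
  m = Mem L sy Q' V S, forall u, u < tl -> Q' u = Q u
  & forall u, u < z -> Q' (tl + u) = E u].
apply: runs_conseq (@runs_loop _ _ L 130 _ _ J _ _ _).
- move=> t s' [tT [rs [m [-> [Q' [-> -> Q'Q Q'E]]]]]]; split; first by lia.
  by exists Q', (prev L).
- by move=> ? ? ? [Q' [-> _ _]].
- move=> z rs m zL [Q' [-> -> Q'Q Q'E]]; apply: runs_seq.
  pose post t s' := t <= 90 /\
    s' = St [:: acc; p; L; hd; tl; z; y; cnt; full; mark_code E z; E z : nat; k; h]
            (Mem L sy Q' V S).
  apply: (@runs_conseq _ _ post).
    move=> t s' [tT ->]; apply: runs_seq; apply: runs_store_arr => //=.
    apply: runs_set => /=; split; first by lia.
    eexists; eexists; split; [reflexivity..|].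
    eexists; split; [reflexivity..| |].
      by move=> u utl; rewrite /update ifF ?Q'Q //; lia.
    move=> u uz; rewrite /update eqn_add2l; case: eqP => [->//|/eqP uNz].
    by apply: Q'E; lia.
  apply: runs_if; rewrite eval_arr //= Q'Q; last by lia.
  rewrite QM // /post E_prev; case: (M z) => /=.
    by apply: runs_set; split.
  apply: runs_if; rewrite eval_arr //= Mem_low // Sst //.
  case stz: (st _) => /=.
    by apply: runs_skip; rewrite andbT; split.
  apply: runs_if => /=; rewrite !Mem_low // addn_eq0 !subn_eq0 -eqn_leq.
  case: ifP => [/negPf symNE|/negbFE symE].
    by apply: runs_set; rewrite symNE andbF; split.
  by apply: runs_skip; rewrite symE andbT; split.
- by exists Q.
Qed.

End Loops.

(** * Reading the input and setting up the queue *)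

Definition scan_sequence : cmd :=
  Seq (Set_reg 12 (Read (Reg 2)))
 (Seq (Store (Reg 2) (Const 0))
 (Seq (Set_reg 2 (Add (Add (Reg 2) (Reg 12)) (Const 1)))
      (Set_reg 11 (Defs.Sub (Reg 11) (Const 1))))).

(* Every input cell that holds no pallet symbol is overwritten by 0; since
   symbols are positive, this tells the two kinds of cells apart. *)
Definition scan : cmd :=
  Seq (Set_reg 11 (Read (Const 0)))
 (Seq (Set_reg 1 (Read (Const 1)))
 (Seq (Store (Const 0) (Const 0))
 (Seq (Store (Const 1) (Const 0))
 (Seq (Set_reg 2 (Const 2))
      (While (Reg 11) scan_sequence))))).

Definition init_queue : cmd :=
  Seq (loop 5 (If (Read (Reg 5)) Skip (Store (aix 0 (Reg 5)) (Const 1))))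
      (Set_reg 4 (Reg 2)).

Definition stack_up : cmd := Seq scan (Seq init_queue search).

(** The input cells after [scan], written as a concatenation of blocks: two cells for [k] and [p],
    then each sequence behind its erased length. *)
Definition symbols (qs : seq (seq nat)) : seq nat :=
  flatten ([:: 0] :: [:: 0] :: [seq 0 :: q | q <- qs]).

Lemma update_nth (pre : seq nat) a b rest :
  update (nth 0 (pre ++ a :: rest)) (size pre) b = nth 0 (pre ++ b :: rest).
Proof.
apply: functional_extensionality => i; rewrite /update !nth_cat.
case: ltngtP => [//|ltpi|->]; last by rewrite subnn.
by rewrite -(subnSK ltpi).
Qed.

(** Induction with the part already scanned as a general prefix [pre]; register 2 points just behind
    it, at the next length. *)
Lemma runs_scan_sequences p (qs : seq (seq nat)) pre h :
  runs (While (Reg 11) scan_sequence)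
    (St [:: 0; p; size pre; 0; 0; 0; 0; 0; 0; 0; 0; size qs; h]
        (nth 0 (pre ++ flatten [seq size q :: q | q <- qs])))
    (fun t s' => t <= size qs * 30 + 5 /\ exists h',
       s' = St [:: 0; p; size (pre ++ flatten [seq 0 :: q | q <- qs]);
                   0; 0; 0; 0; 0; 0; 0; 0; 0; h']
               (nth 0 (pre ++ flatten [seq 0 :: q | q <- qs]))).
Proof.
elim: qs pre h => [|q qs IHqs] pre h.
  eexists; eexists; split; first exact: exec_While_false.
  by split=> //; exists h; rewrite /= cats0.
have /(_ (pre ++ 0 :: q) (size q)) := IHqs.
rewrite -!catA /= => -[t [s' [cs [tT [h' s'E]]]]].
pose rs := [:: 0; p; size pre; 0; 0; 0; 0; 0; 0; 0; 0; (size qs).+1; h].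
pose m := nth 0 (pre ++ size q :: q ++ flatten [seq size q :: q | q <- qs]).
have [t1 [s1 [cs1 [t1T s1E]]]] : runs scan_sequence (St rs m) (fun t s => t <= 20 /\
    s = St [:: 0; p; size (pre ++ 0 :: q); 0; 0; 0; 0; 0; 0; 0; 0; size qs; size q]
         (nth 0 (pre ++ 0 :: q ++ flatten [seq size q :: q | q <- qs]))).
  apply: runs_seq; apply: runs_set; apply: runs_seq; apply: runs_store.
  apply: runs_seq; apply: runs_set; apply: runs_set => /=; split=> //.
  rewrite /m update_nth nth_cat ltnn subnn /= subn1 size_cat /=.
  by rewrite addn1 addnS.
exists (2 + t1 + t), s'; split; last by split; [lia | exists h'].
by apply: exec_While_true cs1 _ => //; rewrite s1E.
Qed.

Lemma runs_scan p (qs : seq (seq nat)) :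
  runs scan (load_input [:: size qs, p & flatten [seq size q :: q | q <- qs]])
    (fun t s' => t <= size qs * 30 + 30 /\ exists h,
       s' = St [:: 0; p; size (symbols qs); 0; 0; 0; 0; 0; 0; 0; 0; 0; h]
               (nth 0 (symbols qs))).
Proof.
set inp := [:: size qs, p & _].
have -> : load_input inp = St (nseq 13 0) (nth 0 inp).
  by congr State; apply: functional_extensionality => i; rewrite nth_nseq; case: ifP.
apply: runs_seq; apply: runs_set; apply: runs_seq; apply: runs_set.
apply: runs_seq; apply: runs_store; apply: runs_seq; apply: runs_store.
apply: runs_seq; apply: runs_set => /=.
rewrite {}/inp (update_nth [::]) (update_nth [:: 0]).
apply: runs_conseq (@runs_scan_sequences p qs [:: 0; 0] 0).
by move=> t s' [tT [h' ->]]; split; [lia | exists h'].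
Qed.

Lemma runs_init_queue p (F : seq nat) h :
  let L := size F in
  runs init_queue
    (St [:: 0; p; L; 0; 0; 0; 0; 0; 0; 0; 0; 0; h] (nth 0 F))
    (fun t s' => t <= L * 60 + 10 /\ exists Q, [/\
       s' = St [:: 0; p; L; 0; L; L; 0; 0; 0; 0; 0; 0; h]
               (Mem L (nth 0 F) Q (fun=> 0) (fun=> 0))
     & forall x, x < L -> Q x = (nth 0 F x == 0)]).
Proof.
move=> L; apply: runs_seq.
pose J x rs m := exists Q, [/\
  rs = [:: 0; p; L; 0; 0; x; 0; 0; 0; 0; 0; 0; h],
  m = Mem L (nth 0 F) Q (fun=> 0) (fun=> 0),
  forall z, x <= z -> Q z = 0
  & forall z, z < x -> Q z = (nth 0 F z == 0)].
apply: runs_conseq (@runs_loop _ _ L 50 _ _ J _ _ _).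
- move=> t s' [tT [rs [m [-> [Q [-> -> _ QE]]]]]]; apply: runs_set => /=.
  split; first by lia.
  by exists Q.
- by move=> ? ? ? [Q [-> _ _]].
- move=> z rs m zL [Q [-> -> Q0 QE]]; apply: runs_if; rewrite /= Mem_low //.
  case Fz: (nth 0 F z == 0) => /=.
    apply: runs_store_arr => //=; split=> //.
    eexists; eexists; split; [reflexivity..|].
    eexists; split; [reflexivity..| |].
      by move=> u zu; rewrite /update ifF ?Q0 //; lia.
    move=> u; rewrite ltnS leq_eqVlt /update; case: eqP => [->|_ /= uz]; last exact: QE.
    by rewrite Fz.
  apply: runs_skip; split=> //; eexists; eexists; split; [reflexivity..|].
  exists Q; split=> //; first by move=> u zu; apply: Q0; lia.
  move=> u; rewrite ltnS leq_eqVlt => /orP[/eqP->|]; last exact: QE.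
  by rewrite Fz Q0.
- exists (fun=> 0); split=> //=.
  (* Memory beyond the input is zero, so all three arrays start as the zero function. *)
  apply: functional_extensionality => a; rewrite /Mem.
  case: ltnP => // La; rewrite nth_default; last by rewrite -/L; lia.
  by case: (_ %% 3) => [|[]].
Qed.

(** * Configurations as marked cells *)

Section Marks.

Variables (B : eqType) (k : nat) (plt : B -> nat) (Q : k.-tuple (seq B)).

Local Notation config := (Defs.config k).

Definition symbol_seqs : seq (seq nat) := [seq map plt q | q <- Q].

Local Notation blocks := ([:: 0] :: [:: 0] :: [seq 0 :: q | q <- symbol_seqs]).
Local Notation sh := (shape blocks).

Definition len : nat := size (symbols symbol_seqs).

Definition sym (x : nat) : nat := nth 0 (symbols symbol_seqs) x.

(* The mark of a cell tells whether its bin has been removed.  The cells that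
   hold no bin (0, 1 and the one in front of each sequence) count as removed, so
   that a bin is at the front iff it is unmarked and the cell before is marked. *)
Definition marks (c : config) (x : nat) : bool :=
  reshape_offset sh x <= nth 0 [:: 0, 0 & c] (reshape_index sh x).

(** The shift by 2 skips the blocks of [k] and [p], the shift by 1 the cell in front of the
    sequence. *)
Definition cell (j : 'I_k) (i : nat) : nat := flatten_index sh j.+2 i.+1.

Definition symbols_of (j : 'I_k) : seq nat := map plt (tnth Q j).

Lemma size_symbols_of j : size (symbols_of j) = size (tnth Q j).
Proof. exact: size_map. Qed.

Lemma nth_blocks (j : 'I_k) : nth [::] blocks j.+2 = 0 :: symbols_of j.
Proof.
have jk : j < size symbol_seqs by rewrite size_map size_tuple.
rewrite /= (nth_map [::]) // (nth_map [::]) ?size_tuple //.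
by rewrite /symbols_of (tnth_nth [::]).
Qed.

Lemma nth_sh (j : 'I_k) : nth 0 sh j.+2 = (size (tnth Q j)).+1.
Proof.
by rewrite (nth_map [::]) ?nth_blocks /= ?size_map // size_tuple !ltnS.
Qed.

Lemma len_sumn : len = sumn sh.
Proof. exact: size_flatten. Qed.

Lemma marks_index c (j : 'I_k) i : i <= size (tnth Q j) ->
  marks c (flatten_index sh j.+2 i) = (i <= tnth c j).
Proof.
move=> iq; rewrite /marks flatten_indexKl ?flatten_indexKr ?nth_sh //=.
by rewrite (tnth_nth 0).
Qed.

Lemma marks_cell c j i : i < size (tnth Q j) -> marks c (cell j i) = (i < tnth c j).
Proof. exact: marks_index. Qed.

Lemma marks_cell_pred c j i : i < size (tnth Q j) ->
  marks c (cell j i).-1 = (i <= tnth c j).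
Proof. by move=> iq; rewrite /cell /flatten_index addnS marks_index // ltnW. Qed.

Lemma sym_cell j i : i < size (tnth Q j) -> sym (cell j i) = nth 0 (symbols_of j) i.
Proof.
move=> iq; rewrite /sym nth_flatten flatten_indexKl ?flatten_indexKr ?nth_sh //.
by rewrite nth_blocks.
Qed.

Lemma cell_lt j i : i < size (tnth Q j) -> cell j i < len.
Proof. by move=> iq; rewrite len_sumn flatten_indexP ?nth_sh. Qed.

Lemma cell_eq j j' i i' : i < size (tnth Q j) -> i' < size (tnth Q j') ->
  (cell j i == cell j' i') = (j == j') && (i == i').
Proof.
move=> iq iq'; apply/eqP/idP => [E|/andP[/eqP-> /eqP->] //].
have := congr1 (reshape_index sh) E; rewrite !flatten_indexKl ?nth_sh //.
case=> jj; have := congr1 (reshape_offset sh) E.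
by rewrite !flatten_indexKr ?nth_sh // => -[->]; rewrite -val_eqE /= jj !eqxx.
Qed.

Lemma cellP x : x < len ->
  (sym x = 0 /\ forall c, marks c x) \/
  exists j i, i < size (tnth Q j) /\ x = cell j i.
Proof.
rewrite len_sumn => xL; have := reshape_indexK sh x.
have := reshape_indexP xL; have := reshape_offsetP xL.
rewrite /marks /sym nth_flatten size_map /= !size_map size_tuple.
case: (reshape_offset _ x) (reshape_index _ x) => [|i] [|[|r]] //=.
- by left.
- by left.
- move=> _ rk; left; split=> //.
  by rewrite (nth_map [::]) // size_map size_tuple.
- rewrite !ltnS => ir rk <-; right; exists (Ordinal rk), i; split=> //.
  by have := nth_sh (Ordinal rk) => /= E; rewrite E in ir.
Qed.

Lemma unmarkedP c x : x < len -> ~~ marks c x ->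
  exists j i, [/\ i < size (tnth Q j), tnth c j <= i & x = cell j i].
Proof.
move=> xL; case: (cellP xL) => [[_ ->] //|[j [i [iq ->]]]].
by rewrite marks_cell // -leqNgt => ci; exists j, i.
Qed.

Definition addable (c : config) (x : nat) : bool :=
  [&& x < len, ~~ marks c x & marks c x.-1].

(** Within a sequence the marked cells form an initial segment that contains the cell in front of
    it, so a change from marked to unmarked occurs only at position [tnth c j]. *)
Lemma addableP c x :
  reflect (exists j, tnth c j < size (tnth Q j) /\ x = cell j (tnth c j))
          (addable c x).
Proof.
apply: (iffP and3P) => [[xL xc xc']|[j [cj ->]]].
  have [j [i [iq ci xE]]] := unmarkedP xL xc.
  move: xc'; rewrite xE marks_cell_pred // => ic.
  have {}ic : i = tnth c j by apply/eqP; rewrite eqn_leq ic.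
  by exists j; rewrite -ic.
by rewrite cell_lt // marks_cell // marks_cell_pred // ltnn leqnn.
Qed.

Definition incr (c : config) (j : 'I_k) : config :=
  [tuple tnth c l + (l == j) | l < k].

Lemma marks_incr c j z : tnth c j < size (tnth Q j) -> z < len ->
  marks (incr c j) z = marks c z || (z == cell j (tnth c j)).
Proof.
move=> cj zL; case: (cellP zL) => [[_ zm]|[j' [i [iq ->]]]]; first by rewrite !zm.
rewrite !marks_cell // cell_eq // tnth_mktuple.
by case: eqP => [->|_]; rewrite ?addn0 ?orbF //= addn1 ltnS leq_eqVlt orbC.
Qed.

Definition wf (c : config) : Prop := forall j, tnth c j <= size (tnth Q j).

Lemma wf_incr c j : tnth c j < size (tnth Q j) -> wf c -> wf (incr c j).
Proof.
move=> cj wfc l; rewrite tnth_mktuple; case: eqP => [->|_]; rewrite ?addn1 //.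
by rewrite addn0.
Qed.

Lemma wf_final : wf (final Q).
Proof. by move=> j; rewrite tnth_mktuple. Qed.

Lemma step_incr c j : tnth c j < size (tnth Q j) -> step Q c (incr c j).
Proof. by move=> cj; apply/existsP; exists j; rewrite cj eqxx. Qed.

Lemma marks_inj c c' : wf c -> wf c' ->
  {in gtn len, marks c =1 marks c'} -> c = c'.
Proof.
move=> wfc wfc' cc'; apply: eq_from_tnth => j.
have le d d' : wf d -> wf d' -> {in gtn len, marks d =1 marks d'} ->
    tnth d j <= tnth d' j.
  move=> wfd wfd' dd'; rewrite leqNgt; apply/negP => lt_d.
  have dq := leq_trans lt_d (wfd j).
  by have := dd' _ (cell_lt dq); rewrite !marks_cell // lt_d ltnn.
by apply/eqP; rewrite eqn_leq !le // => x xL; rewrite cc'.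
Qed.

Lemma marks_final x : x < len -> marks (final Q) x.
Proof.
move=> xL; case: (cellP xL) => [[_ ->] //|[j [i [iq ->]]]].
by rewrite marks_cell // tnth_mktuple.
Qed.

Lemma all_marks c : wf c -> all (marks c) (iota 0 len) = (c == final Q).
Proof.
move=> wfc; apply/allP/eqP => [allc|-> x]; last first.
  by rewrite mem_iota => /andP[_]; apply: marks_final.
apply: marks_inj => //; first exact: wf_final.
by move=> x xL; rewrite marks_final // allc // mem_iota.
Qed.

Local Notation started c := (started len sym (marks c)).

Lemma startedP c t :
  reflect (exists x, [/\ x < len, marks c x & sym x = t]) (started c t).
Proof.
apply: (iffP hasP) => [[x]|[x [xL xc <-]]].
  by rewrite mem_iota => /andP[_ xL] /andP[xc /eqP xt]; exists x.
by exists x; rewrite ?mem_iota // xc eqxx.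
Qed.

Variable p : nat.
Hypothesis valid : valid_instance plt Q p.

Lemma mem_pallets j i : i < size (tnth Q j) -> nth 0 (symbols_of j) i \in pallets plt Q.
Proof.
move=> iq; rewrite mem_undup map_flatten; apply/flattenP; exists (symbols_of j).
  by apply: map_f; exact: mem_tnth.
by rewrite mem_nth // size_symbols_of.
Qed.

Lemma sym_gt0 j i : i < size (tnth Q j) -> 0 < nth 0 (symbols_of j) i.
Proof.
case: valid => _ pos _ _; move/mem_pallets; rewrite mem_undup => /mapP[b bQ ->].
exact: pos.
Qed.

Lemma pallets_sym t : t \in pallets plt Q -> 0 < t.
Proof. by case: valid => _ pos _ _; rewrite mem_undup => /mapP[b /pos b0 ->]. Qed.

Lemma has_take (s : seq B) n t :
  reflect (exists i, [/\ i < n, i < size s & nth 0 (map plt s) i = t])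
          (has (fun b => plt b == t) (take n s)).
Proof.
have -> : has (fun b => plt b == t) (take n s) = (t \in take n (map plt s)).
  by rewrite -map_take -has_pred1 has_map.
apply: (iffP (nthP 0)) => [[i]|[i [ltin ltis it]]].
  rewrite size_take_min size_map leq_min => /andP[ltin ltis].
  by rewrite nth_take // => it; exists i.
by exists i; rewrite ?nth_take // size_take_min size_map leq_min ltin.
Qed.

Lemma has_drop (s : seq B) n t :
  reflect (exists i, [/\ n <= i, i < size s & nth 0 (map plt s) i = t])
          (has (fun b => plt b == t) (drop n s)).
Proof.
have -> : has (fun b => plt b == t) (drop n s) = (t \in drop n (map plt s)).
  by rewrite -map_drop -has_pred1 has_map.
apply: (iffP (nthP 0)) => [[i]|[i [leni ltis it]]].
  rewrite size_drop size_map ltn_subRL nth_drop => ltis it.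
  by exists (n + i); rewrite leq_addr.
by exists (i - n); rewrite ?nth_drop ?subnKC // size_drop size_map ltn_sub2r ?(leq_ltn_trans leni).
Qed.

(** Symbol 0 counts as started in every configuration because of the cells without a bin; as bins
    carry positive symbols, this adds no open pallet. *)
Lemma is_openP c t :
  reflect (started c t /\ exists x, [/\ x < len, ~~ marks c x & sym x = t])
          (is_open plt Q c t).
Proof.
apply: (iffP existsP) => [[j /existsP[l /andP[]]]|].
  case/has_take=> i [ic iq it] /has_drop[i' [ic' iq' it']]; split.
    apply/startedP; exists (cell j i).
    by rewrite cell_lt // marks_cell // sym_cell.
  by exists (cell l i'); rewrite cell_lt // marks_cell // sym_cell // -leqNgt.
case=> /startedP[x [xL xc xt]] [y [yL yc yt]].
have [l [i' [iq' ic' yE]]] := unmarkedP yL yc.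
move: yt; rewrite yE sym_cell // => yt.
case: (cellP xL) => [[x0 _]|[j [i [iq xE]]]].
  by have := sym_gt0 iq'; rewrite yt -xt x0.
exists j; apply/existsP; exists l; rewrite xE marks_cell // sym_cell // in xc xt.
by apply/andP; split; [apply/has_take; exists i | apply/has_drop; exists i'].
Qed.

Lemma is_open_pallet c t : is_open plt Q c t -> t \in pallets plt Q.
Proof.
case/is_openP=> _ [x [xL /(unmarkedP xL)[j [i [iq _ ->]]] <-]].
by rewrite sym_cell // mem_pallets.
Qed.

Lemma size_open_syms c :
  size (undup (open_syms len sym (marks c) len)) = num_open plt Q c.
Proof.
rewrite /num_open -size_filter; apply/perm_size/uniq_perm.
- exact: undup_uniq.
- by rewrite filter_uniq // undup_uniq.
move=> t; rewrite mem_undup mem_filter.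
apply/mapP/andP => [[x]|[/is_openP[st [x [xL xc xt]]] _]].
  rewrite mem_filter mem_iota => /andP[/andP[xc xst] /andP[_ xL]] ->.
  have xo : is_open plt Q c (sym x) by apply/is_openP; split=> //; exists x.
  by rewrite xo (is_open_pallet xo).
by exists x => //; rewrite mem_filter mem_iota xc xt st.
Qed.

(** * Reachable configurations and the successors of decision configurations *)

Definition reachable (c : config) : Prop := exists s : seq config,
  [/\ path (step Q) (initial k) s, last (initial k) s = c
    & all (fun d => num_open plt Q d <= p) (initial k :: s)].

Definition decision (c : config) : Prop :=
  forall x, addable c x -> ~~ started c (sym x).

Lemma marks_initial x : x < len -> marks (initial k) x = (sym x == 0).
Proof.
move=> xL; case: (cellP xL) => [[-> ->] //|[j [i [iq ->]]]].
by rewrite marks_cell // tnth_mktuple sym_cell // gtn_eqF // sym_gt0.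
Qed.

Lemma started_initial t : started (initial k) t -> t = 0.
Proof. by case/startedP=> x [xL]; rewrite marks_initial // => /eqP-> <-. Qed.

Lemma wf_initial : wf (initial k).
Proof. by move=> j; rewrite tnth_mktuple. Qed.

Lemma decision_initial : decision (initial k).
Proof.
move=> x /and3P[xL]; rewrite marks_initial // => x0 _.
by apply/negP => /started_initial xE; rewrite xE in x0.
Qed.

Lemma reachable_initial : reachable (initial k).
Proof.
exists [::]; split=> //=; rewrite andbT /num_open (eq_count (a2 := pred0)) ?count_pred0 //.
move=> t; apply/negbTE/negP => t_open.
have := pallets_sym (is_open_pallet t_open).
by case/is_openP: t_open => /started_initial->.
Qed.

Lemma reachable_step c c' :
  reachable c -> step Q c c' -> num_open plt Q c' <= p -> reachable c'.
Proof.
move=> [s [sp sl sa]] cc' c'p; exists (rcons s c'); split.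
- by rewrite rcons_path sp sl.
- by rewrite last_rcons.
- by rewrite -rcons_cons all_rcons c'p.
Qed.

Lemma num_openS c d t : {subset is_open plt Q d <= predU1 t (is_open plt Q c)} ->
  num_open plt Q d <= (num_open plt Q c).+1.
Proof.
move=> dc; rewrite /num_open -[X in _ <= X]add1n.
have le1 : count (pred1 t) (pallets plt Q) <= 1.
  by rewrite count_uniq_mem ?undup_uniq // leq_b1.
apply: leq_trans (leq_add le1 (leqnn _)).
rewrite -count_predUI; apply: leq_trans (leq_addr _ _).
by apply: sub_count => u /dc; rewrite !inE.
Qed.

Definition next_marks (c : config) (y : nat) : nat -> bool :=
  extended sym (marks c) (fun t => started c t || (t == sym y)).

Lemma next_marksE c y x : next_marks c y x =
  marks c x || (if x is x'.+1 then
    next_marks c y x' && (started c (sym x) || (sym x == sym y)) else false).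
Proof. by case: x. Qed.

Lemma marks_next c y x : marks c x -> next_marks c y x.
Proof. by rewrite next_marksE => ->. Qed.

Lemma next_marks_self c y : addable c y -> next_marks c y y.
Proof.
case/and3P=> yL yc yc'; rewrite next_marksE; case: y yc' yL yc => [->//|y] /= yc' _ _.
by rewrite marks_next // eqxx orbT orbT.
Qed.

(* The marks of next_marks c y can be added from left to right without ever
   opening a pallet other than that of y. *)
Lemma next_config c y :
  wf c -> reachable c -> num_open plt Q c < p ->
  exists c', [/\ wf c', reachable c'
                & {in gtn len, marks c' =1 next_marks c y}].
Proof.
move=> wfc reach_c cp.
(* Induction on the sweep: below [z] the marks are those of [next_marks c y], from [z] on still
   those of [c]. *)
have next_z z : z <= len -> exists c', [/\ wf c', reachable c' &
  forall x, x < len -> marks c' x = if x < z then next_marks c y x else marks c x].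
  elim: z => [|z IHz] zL; first by exists c.
  have [c' [wfc' reach_c' c'E]] := IHz (ltnW zL).
  have c'z := c'E z zL; rewrite ltnn in c'z.
  have [zc|zc] := boolP (marks c z); [|have [zn|zn] := boolP (next_marks c y z)].
  - exists c'; split=> // x xL; rewrite c'E // [x < z.+1]ltnS [x <= z]leq_eqVlt.
    by case: eqP => [->|//]; rewrite ltnn zc marks_next.
  - have zadd : addable c' z.
      rewrite /addable zL c'z zc /=.
      move: zn; rewrite next_marksE (negPf zc); case: z zL {IHz c'z zc} c'E => //= z zL c'E.
      by case/andP=> zn _; rewrite c'E ?ltnS ?leqnn // ltnW.
    case/addableP: zadd => j [jc' zE].
    have mE x : x < len -> marks (incr c' j) x =
        if x < z.+1 then next_marks c y x else marks c x.
      move=> xL; rewrite marks_incr // c'E // -zE [x < z.+1]ltnS [x <= z]leq_eqVlt.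
      by case: eqP => [->|_]; rewrite ?zn ?orbT ?orbF.
    exists (incr c' j); split=> //; first exact: wf_incr.
    apply: reachable_step reach_c' (step_incr jc') _.
    (* Besides the pallet of [y], a pallet open now is open in [c]: its started status comes from
       [c], and its unmarked cell was unmarked there. *)
    apply: leq_trans cp; apply: (@num_openS _ _ (sym y)) => t.
    case/is_openP=> /startedP[x [xL xm xt]] [u [uL um ut]].
    have ucm : ~~ marks c u.
      by apply: contra um; rewrite mE //; case: ifP => // _; apply: marks_next.
    rewrite !inE; case: eqP => //= tNy; apply/is_openP; split; last by exists u.
    move: xm; rewrite mE //; case: ifP => _ xm; last by apply/startedP; exists x.
    move: xm; rewrite next_marksE; case/orP=> [xm|]; first by apply/startedP; exists x.
    by case: x xL xt => // x _ ->; case/andP=> _ /orP[//|/eqP].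
  - exists c'; split=> // x xL; rewrite c'E // [x < z.+1]ltnS [x <= z]leq_eqVlt.
    by case: eqP => [->|//]; rewrite ltnn (negPf zc) (negPf zn).
have [c' [wfc' reach_c' c'E]] := next_z len (leqnn _).
by exists c'; split=> // x xL; have {}xL : x < len := xL; rewrite c'E // xL.
Qed.

Lemma started_next c c' y t : addable c y ->
  {in gtn len, marks c' =1 next_marks c y} ->
  started c' t = started c t || (t == sym y).
Proof.
move=> yadd c'E; have yL : y < len by case/and3P: yadd.
apply/startedP/orP => [[x [xL xm xt]]|[/startedP[x [xL xm xt]]|/eqP->]].
- move: xm; rewrite c'E // next_marksE; case/orP => [xm|].
    by left; apply/startedP; exists x.
  by case: x xL xt => // x _ ->; case/andP=> _ /orP[]; [left|right].
- by exists x; rewrite c'E // marks_next.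
- by exists y; rewrite c'E // next_marks_self.
Qed.

(** One sweep suffices because the pallets it may remove are fixed at its start: a front bin of such
    a pallet has a marked predecessor, so the sweep would have marked it. *)
Lemma decision_next c c' y : addable c y ->
  {in gtn len, marks c' =1 next_marks c y} -> decision c'.
Proof.
move=> yadd c'E x /and3P[xL xc' xc'1]; rewrite (started_next _ yadd c'E).
apply: contra xc'; rewrite c'E // next_marksE.
case: x xL xc'1 => [xL|x xL /= xc'1 ->]; first by rewrite c'E // next_marksE => ->.
by rewrite -c'E ?xc'1 ?orbT //; apply: ltnW.
Qed.

Lemma count_memP (s : seq nat) x : x < size s -> 2 <= count_mem (nth 0 s x) s ->
  exists y, [/\ y < size s, y != x & nth 0 s y = nth 0 s x].
Proof.
move=> xs; set t := nth 0 s x; rewrite -[in count _ s](cat_take_drop x s).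
rewrite (drop_nth 0 xs) count_cat /= -/t eqxx.
have [|tt] := boolP (t \in take x s).
  move=> /(nthP 0)[y]; rewrite size_take xs => yx; rewrite nth_take // => yt _.
  by exists y; rewrite (ltn_trans yx) // ltn_eqF.
have [|td] := boolP (t \in drop x.+1 s).
  move=> /(nthP 0)[y]; rewrite size_drop ltn_subRL nth_drop => yx yt _.
  by exists (x.+1 + y); rewrite gtn_eqF // addSn ltnS leq_addr.
by rewrite (count_memPn tt) (count_memPn td).
Qed.

(** Here the assumption of two bins per pallet enters: removing the first bin of a pallet leaves
    another one, so the pallet really becomes open. *)
Lemma twin x : x < len -> sym x != 0 ->
  exists y, [/\ y < len, y != x & sym y = sym x].
Proof.
move=> xL x0; apply: count_memP => //; rewrite -/(sym x).
case: (cellP xL) => [[xE _]|[j [i [iq xE]]]]; first by rewrite xE in x0.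
have := mem_pallets iq; rewrite -sym_cell // -xE.
case: valid => _ _ two _ /two; rewrite /symbols /= eq_sym (negPf x0) !add0n.
rewrite /bins /symbol_seqs !count_flatten -!map_comp.
suff -> : [seq (count (fun b => plt b == sym x) q) | q <- Q] =
  [seq (count_mem (sym x) \o (cons 0 \o map plt)) q | q <- Q] by [].
apply: eq_map => q /=; rewrite eq_sym (negPf x0) count_map.
by apply: eq_count.
Qed.

(* By induction on the processing: as long as its configurations have their
   removed bins among those of D and the same started pallets as D, the next
   bin not removed in D opens a pallet, and the successor of D takes over. *)
Lemma decision_dominates (R : seq config) :
  initial k \in R -> (forall c, c \in R -> decision c) ->
  (forall c y, c \in R -> addable c y -> num_open plt Q c < p ->
     exists2 c', c' \in R & {in gtn len, marks c' =1 next_marks c y}) ->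
  forall c, reachable c -> exists D, [/\ D \in R,
    forall x, x < len -> marks c x -> marks D x
    & forall t, started D t = started c t].
Proof.
move=> R0 Rdecision Rnext c [s [sp <- sa]] {c}.
elim/last_ind: s sp sa => [_ _|s c' IHs]; first by exists (initial k); split.
rewrite rcons_path -rcons_cons all_rcons => /andP[sp cc'] /andP[c'p sa].
have [D [RD cD stD]] := IHs sp sa; rewrite last_rcons.
move: (last _ s) cc' cD stD => c /existsP[j /andP[jc /eqP c'E]] cD stD.
have yadd : addable c (cell j (tnth c j)) by apply/addableP; exists j.
have mc' z : z < len -> marks c' z = marks c z || (z == cell j (tnth c j)).
  by move=> zL; rewrite c'E -/(incr c j) marks_incr.
move: (cell j _) yadd mc' => y yadd mc' {c'E}.
have [yL yc yc'] := and3P yadd.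
have stc' t : started c' t = started c t || (t == sym y).
  apply/startedP/orP => [[x [xL]]|[/startedP[x [xL xm xt]]|/eqP->]].
  - rewrite mc' // => /orP[xm xt|/eqP-> <-]; last by right.
    by left; apply/startedP; exists x.
  - by exists x; rewrite mc' // xm.
  - by exists y; rewrite mc' // eqxx orbT.
(* If [D] has already removed [y], then its pallet is started in [D], hence in [c], and [D] still
   serves. *)
have [yD|yD] := boolP (marks D y).
  exists D; split=> // [x xL|t].
    by rewrite mc' // => /orP[/(cD _ xL)|/eqP->].
  rewrite stc' stD; case: eqP => [->|_]; rewrite ?orbF // orbT -stD.
  by apply/startedP; exists y.
have y'L : y.-1 < len by rewrite (leq_ltn_trans (leq_pred _)).
have yaddD : addable D y by rewrite /addable yL yD cD.
have y_new := Rdecision D RD y yaddD.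
have sy0 : sym y != 0.
  case: (cellP yL) => [[_ ym]|[i [a [iq ->]]]]; first by rewrite ym in yD.
  by rewrite sym_cell // -lt0n sym_gt0.
have y_open : is_open plt Q c' (sym y).
  apply/is_openP; split; first by rewrite stc' eqxx orbT.
  have [z [zL zNy zy]] := twin yL sy0.
  exists z; split=> //; rewrite mc' // (negPf zNy) orbF.
  by apply: contra y_new => zc; rewrite stD; apply/startedP; exists z.
(* Every pallet open in [D] is open in [c'], and so is the pallet of [y], which is not started in
   [D]; hence [D] has strictly fewer open pallets than [c']. *)
have Dp : num_open plt Q D < p.
  apply: leq_trans c'p; rewrite /num_open -!size_filter.
  set l := [seq t <- _ | is_open _ _ D t].
  rewrite -[(size l).+1]/(size (sym y :: l)); apply: uniq_leq_size.
    rewrite /= filter_uniq ?undup_uniq // andbT mem_filter.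
    by apply: contra y_new => /andP[/is_openP[]].
  move=> t; rewrite inE !mem_filter => /predU1P[->|/andP[tD tP]].
    by rewrite y_open (is_open_pallet y_open).
  rewrite tP andbT; case/is_openP: tD => stDt [x [xL xD xt]].
  apply/is_openP; split; first by rewrite stc' -stD stDt.
  exists x; split=> //; rewrite mc' // negb_or; apply/andP; split.
    by apply: contra xD; apply: cD.
  by apply: contra y_new => /eqP <-; rewrite xt.
have [D' RD' D'E] := Rnext _ _ RD yaddD Dp.
exists D'; split=> // [x xL|t]; last by rewrite stc' (started_next _ yaddD D'E) stD.
rewrite D'E // mc' // => /orP[/(cD _ xL)|/eqP->]; first exact: marks_next.
exact: next_marks_self.
Qed.

Lemma fifo_stackupE : fifo_stackup plt Q p <-> reachable (final Q).
Proof.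
split=> [[s /andP[sp /eqP sl] sa]|[s [sp sl sa]]]; first by exists s.
by exists s; rewrite // /processing sp sl eqxx.
Qed.

(** [R] will be the queue when the search ends. A member dominating [final Q] has all bins removed
    and therefore equals it. *)
Lemma reachable_final (R : seq config) :
  initial k \in R ->
  (forall c, c \in R -> [/\ wf c, reachable c & decision c]) ->
  (forall c y, c \in R -> addable c y -> num_open plt Q c < p ->
     exists2 c', c' \in R & {in gtn len, marks c' =1 next_marks c y}) ->
  final Q \in R <-> fifo_stackup plt Q p.
Proof.
move=> R0 RP Rnext; rewrite fifo_stackupE; split=> [/RP[]//|reach_f].
have [|D [RD fD _]] := decision_dominates R0 _ Rnext reach_f; first by move=> c /RP[].
have [wfD _ _] := RP _ RD.
suff <- : D = final Q by [].
apply: marks_inj => //; first exact: wf_final.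
by move=> x xL; rewrite marks_final // fD // marks_final.
Qed.

End Marks.

(** * The number of decision configurations *)

Section Counting.

Variables (B : eqType) (k : nat) (plt : B -> nat) (Q : k.-tuple (seq B)).
Variable p : nat.
Hypothesis valid : valid_instance plt Q p.

Local Notation config := (Defs.config k).
Local Notation symbols_of := (symbols_of plt Q).

Definition decision_bound : nat := \prod_(j < k) (size (undup (symbols_of j))).+1.

(** The positions a decision configuration can have in one sequence: its end, or a bin that is the
    first of its pallet there. The common bound [n] gives all sequences one finite type. *)
Definition stop_positions (j : 'I_k) (n : nat) : pred 'I_n.+1 := fun i =>
  (i == size (tnth Q j) :> nat) ||
  (i < size (tnth Q j)) && (nth 0 (symbols_of j) i \notin take i (symbols_of j)).

(** A stop position is determined by its symbol, with the default 0 of [nth] standing for the end;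
    positive symbols keep the end apart. *)
Lemma card_stop_positions j n :
  #|@stop_positions j n| <= (size (undup (symbols_of j))).+1.
Proof.
pose g (i : 'I_n.+1) := nth 0 (symbols_of j) i.
rewrite cardE -(size_map g).
apply: (@uniq_leq_size _ _ (0 :: undup (symbols_of j))); last first.
  move=> _ /mapP[i _ ->]; rewrite inE mem_undup /g.
  have [iq|iq] := ltnP i (size (symbols_of j)); last by rewrite nth_default.
  by rewrite mem_nth // orbT.
have inj (i i' : 'I_n.+1) : stop_positions j i -> stop_positions j i' -> i < i' -> g i != g i'.
  rewrite /stop_positions /g => /orP[/eqP->|/andP[iq _]].
    case/orP=> [/eqP->|/andP[i'q _] qi']; first by rewrite ltnn.
    by have := ltn_trans qi' i'q; rewrite ltnn.
  case/orP=> [/eqP-> _|/andP[i'q] + ii'].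
    by rewrite [X in _ != X]nth_default ?size_symbols_of // -lt0n (sym_gt0 valid).
  apply: contra => /eqP <-; rewrite -(nth_take 0 ii') mem_nth //.
  by rewrite size_take size_symbols_of i'q.
rewrite map_inj_in_uniq ?enum_uniq // => i i'; rewrite !mem_enum => iS i'S gE.
case: (ltngtP i i') => [lt_i|lt_i|/val_inj //].
  by have := inj _ _ iS i'S lt_i; rewrite gE eqxx.
by have := inj _ _ i'S iS lt_i; rewrite gE eqxx.
Qed.

(** An earlier bin of the same pallet in this sequence would already be removed, so the front bin
    would belong to a started pallet. *)
Lemma decision_stop c j : wf Q c -> decision plt Q c ->
  tnth c j = size (tnth Q j) \/
  tnth c j < size (tnth Q j) /\
  nth 0 (symbols_of j) (tnth c j) \notin take (tnth c j) (symbols_of j).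
Proof.
move=> wfc clc; have := wfc j; rewrite leq_eqVlt => /orP[/eqP|cj]; first by left.
right; split=> //; have /clc : addable plt Q c (cell plt Q j (tnth c j)).
  by apply/addableP; exists j.
rewrite sym_cell //; apply: contra => /(nthP 0)[i]; rewrite size_take size_symbols_of cj.
move=> ic; rewrite nth_take // => iE.
have iq := ltn_trans ic cj.
apply/startedP; exists (cell plt Q j i).
by rewrite cell_lt // marks_cell // sym_cell.
Qed.

(** Entries are at most [n], so coding them as ordinals loses nothing; the images lie in a family of
    functions whose cardinality is a product. *)
Lemma size_decision (R : seq config) :
  uniq R -> (forall c, c \in R -> wf Q c /\ decision plt Q c) ->
  size R <= decision_bound.
Proof.
move=> uR RP; pose n := \max_(j < k) size (tnth Q j).
have le_n j : size (tnth Q j) <= n.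
  exact: (@leq_bigmax _ (fun j : 'I_k => size (tnth Q j))).
pose g (c : config) := [ffun j : 'I_k => inord (tnth c j) : 'I_n.+1].
have gE c j : c \in R -> g c j = tnth c j :> nat.
  by case/RP=> wfc _; rewrite ffunE inordK // ltnS (leq_trans (wfc j)).
rewrite -(size_map g); have uG : uniq (map g R).
  rewrite map_inj_in_uniq // => c c' Rc Rc' cc'; apply: eq_from_tnth => j.
  by rewrite -!gE // cc'.
rewrite -(card_uniqP uG).
apply: (@leq_trans #|family (fun j => @stop_positions j n)|).
  apply: subset_leq_card; apply/subsetP => _ /mapP[c Rc ->].
  apply/familyP => j; have [wfc clc] := RP c Rc.
  rewrite -topredE /= /stop_positions gE //.
  by case: (decision_stop j wfc clc) => [->|[-> ->]]; rewrite ?eqxx ?orbT.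
rewrite card_family foldrE big_map /decision_bound -big_enum /=.
by rewrite !big_enum /=; apply: leq_prod => j _; apply: card_stop_positions.
Qed.

Lemma num_bins_sum : num_bins Q = \sum_(j < k) size (tnth Q j).
Proof. by rewrite /num_bins /bins size_flatten sumnE big_map big_tuple. Qed.

Lemma len_sum : len plt Q = num_bins Q + k + 2.
Proof.
rewrite /len /symbols /= size_flatten sumnE /shape -!map_comp big_map big_tuple.
rewrite (eq_bigr (fun j => size (tnth Q j) + 1)); last by move=> j _ /=; rewrite size_map addn1.
by rewrite big_split /= -num_bins_sum sum1_card card_ord addn2.
Qed.

(** Compared factor by factor: a nonempty sequence contributes at most m + 1, an empty one
    contributes 1 times 3, and [3 <= m + 2] since some pallet exists. *)
Lemma decision_bound_empty : 0 < num_bins Q ->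
  decision_bound * 3 ^ (\sum_(j < k) (size (tnth Q j) == 0))
  <= (num_pallets plt Q + 2) ^ k.
Proof.
move=> n0; rewrite expn_sum /decision_bound -big_split /=.
rewrite -[k in _ ^ k]card_ord -prod_nat_const; apply: leq_prod => j _.
have m_gt0 : 0 < num_pallets plt Q.
  rewrite /num_pallets lt0n size_eq0; apply: contraL n0 => /eqP/undup_nil/eqP.
  by rewrite -size_eq0 size_map -leqn0 -ltnNge /num_bins; case: (size _).
case: eqP => [q0|_].
  rewrite /symbols_of (size0nil q0) /=; lia.
rewrite expn0 muln1 addn2 ltnS leqW //; apply: uniq_leq_size; first exact: undup_uniq.
move=> t; rewrite mem_undup => /(nthP 0)[i]; rewrite size_symbols_of => iq <-.
exact: mem_pallets.
Qed.

Lemma le_expn3 e : e.+1 ^ 2 <= 2 * 3 ^ e.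
Proof.
(* The case 1 is treated apart, since [(e + 2) ^ 2 <= 3 * (e + 1) ^ 2] fails for [e = 0]. *)
elim: e => // -[//|e] IHe; rewrite [3 ^ _]expnS mulnCA.
apply: leq_trans (leq_mul (leqnn 3) IHe); rewrite -!mulnn; nia.
Qed.

Lemma time_bound : 0 < num_bins Q ->
  decision_bound * (len plt Q + 1) ^ 2
  <= 50 * (num_bins Q ^ 2 * (num_pallets plt Q + 2) ^ k).
Proof.
move=> n0; have := decision_bound_empty n0.
set e := \sum_(j < k) _ => le_bound.
have ke : k <= num_bins Q + e.
  rewrite num_bins_sum -big_split /= -[k in k <= _]card_ord -sum1_card.
  by apply: leq_sum => j _; case: (size _).
(* From [k <= n + e] one gets [n + k + 3 <= 2 * n + e + 3 <= 5 * n * (e + 1)]; the constant 50 is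
   [5 ^ 2] times the 2 of [le_expn3]. *)
have le_len : (len plt Q + 1) ^ 2 <= (5 * num_bins Q * e.+1) ^ 2.
  by rewrite leq_exp2r // len_sum; nia.
apply: leq_trans (leq_mul (leqnn _) le_len) _.
rewrite !expnMn; have := le_expn3 e.
move: (_ ^ k) (3 ^ e) (e.+1 ^ 2) (num_bins Q ^ 2) le_bound => a b c d le_bound le_cb.
apply: (@leq_trans (decision_bound * (25 * d * (2 * b)))).
  by rewrite !leq_mul.
apply: leq_trans (leq_mul (leqnn 50) (leq_mul (leqnn d) le_bound)); lia.
Qed.

End Counting.

(** * Correctness of the search *)

Lemma eq_mark_code (E E' : nat -> bool) n :
  {in gtn n, E =1 E'} -> mark_code E n = mark_code E' n.
Proof.
elim: n => //= n IHn EE'; rewrite IHn ?EE' // -?topredE //=.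
by move=> x xn; apply: EE'; apply: ltnW.
Qed.

(** Parity recovers the last binary digit. Thus equal codes mean equal configurations, and one array
    lookup decides membership. *)
Lemma mark_code_inj (E E' : nat -> bool) n :
  mark_code E n = mark_code E' n -> {in gtn n, E =1 E'}.
Proof.
elim: n => [_ x //|n IHn /= codeE x].
have [EE' En] : mark_code E n = mark_code E' n /\ E n = E' n.
  by move: codeE; case: (E n); case: (E' n) => /= codeE; split=> //; lia.
rewrite -[x \in _]/(x < n.+1) ltnS leq_eqVlt => /orP[/eqP-> //|xn].
exact: IHn.
Qed.

Section Search.

Variables (B : eqType) (k : nat) (plt : B -> nat) (Q : k.-tuple (seq B)).
Variable p : nat.
Hypothesis valid : valid_instance plt Q p.

Local Notation config := (Defs.config k).
Local Notation L := (len plt Q).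
Local Notation sy := (sym plt Q).
Local Notation marks := (marks plt Q).
Local Notation c0 := (initial k).

Definition code (c : config) : nat := mark_code (marks c) L.

(* The queue is initial :: rest; the code of initial is never recorded, as no
   other configuration leads back to it. *)
Definition good_queue (rest : seq config) : Prop :=
  uniq rest /\
  forall c, c \in rest -> [/\ wf Q c, reachable plt Q p c & decision plt Q c].

Definition queue_mem (rest : seq config) (A V : nat -> nat) : Prop :=
  (forall i x, i <= size rest -> x < L ->
     A (i * L + x) = marks (nth c0 (c0 :: rest) i) x)
  /\ forall a, (V a != 0) = (a \in map code rest).

(** The bound [y] records the progress of the loop over front bins; [y = L] means that all
    successors are present. *)
Definition expanded (c : config) (R : seq config) (y : nat) : Prop :=
  forall y', y' < y -> addable plt Q c y' ->
    exists2 c', c' \in R & {in gtn L, marks c' =1 next_marks plt Q c y'}.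

Lemma good_queue_mem rest c : good_queue rest -> c \in c0 :: rest ->
  [/\ wf Q c, reachable plt Q p c & decision plt Q c].
Proof.
case=> _ restP; rewrite inE => /predU1P[->|/restP //]; split.
- exact: wf_initial.
- exact: reachable_initial valid.
- exact: decision_initial valid.
Qed.

Lemma sub_expanded c (R R' : seq config) y :
  {subset R <= R'} -> expanded c R y -> expanded c R' y.
Proof.
by move=> RR' Rc y' y'y /(Rc _ y'y)[c' /RR' R'c' c'E]; exists c'.
Qed.

Lemma runs_successor rest h c acc x y cnt full cd v kk hh A V S :
  good_queue rest -> queue_mem rest A V -> h <= size rest ->
  c = nth c0 (c0 :: rest) h -> addable plt Q c y -> num_open plt Q c < p ->
  (forall z, z < L -> (S (sy z) != 0) = started L sy (marks c) (sy z)) ->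
  runs (Seq extend push)
    (St [:: acc; p; L; h * L; (size rest).+1 * L; x; y; cnt; full; cd; v; kk; hh]
        (Mem L sy A V S))
    (fun t s' => t <= L * 150 + 60 /\ exists cd' v' A' V' ext, let rest' := rest ++ ext in
      [/\ s' = St [:: acc; p; L; h * L; (size rest').+1 * L; L; y; cnt; full;
                      cd'; v'; kk; hh] (Mem L sy A' V' S),
          good_queue rest', queue_mem rest' A' V'
        & exists2 c', c' \in rest' & {in gtn L, marks c' =1 next_marks plt Q c y}]).
Proof.
move=> good [Amem Vmem] h_rest cE yadd cp S_started.
have cR : c \in c0 :: rest by rewrite cE mem_nth.
have [wfc reach_c _] := good_queue_mem good cR.
have [c' [wfc' reach_c' c'E]] := next_config valid y wfc reach_c cp.
have yL : y < L by case/and3P: yadd.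
have dec_c' := decision_next yadd c'E.
apply: runs_seq.
have headA z : z < L -> A (h * L + z) = marks c z by move=> zL; rewrite Amem -?cE.
have tlh : h * L + L <= (size rest).+1 * L by rewrite addnC -mulSn leq_mul2r ltnS h_rest orbT.
apply: runs_conseq (runs_extend _ _ headA _ _ _ _ _ _ _ _ S_started tlh yL).
move=> t s' [tT [A' [v' [-> A'A A'E]]]].
rewrite -/(next_marks plt Q c y) in A'E *.
have codeE : mark_code (next_marks plt Q c y) L = code c'.
  by apply: eq_mark_code => z zL; rewrite c'E.
have A'mem i z : i <= size rest -> z < L ->
    A' (i * L + z) = marks (nth c0 (c0 :: rest) i) z.
  move=> i_rest zL; rewrite A'A ?Amem //; apply: (@leq_trans (i.+1 * L)).
    by rewrite mulSn addnC ltn_add2r.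
  by rewrite leq_mul2r ltnS i_rest orbT.
rewrite codeE; apply: runs_if; rewrite eval_arr //= Vmem; case: ifP => [old|new].
  apply: runs_skip; split; first by lia.
  exists (code c'), v', A', V, [::]; rewrite cats0; split=> //.
  (* A recorded code belongs to a queued configuration with the same marks, so the successor is
     already there. *)
  have /mapP[d Rd dE] := old; exists d => // z zL; rewrite -c'E //.
  by rewrite (mark_code_inj dE zL).
apply: runs_seq; apply: runs_store_arr => //=; apply: runs_set => /=.
split; first by lia.
exists (code c'), v', A', (update V (code c') 1), [:: c'].
rewrite cats1 size_rcons; have c'_new : c' \notin rest.
  by apply: contraFN new; apply: map_f.
split=> //.
- by rewrite [X in _ = St [:: _, _, _, _, X & _] _]mulSn addnC.
- split; first by rewrite rcons_uniq c'_new; case: good.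
  move=> d; rewrite mem_rcons inE => /predU1P[->|]; first by [].
  by case: good => _; apply.
- split=> [i z|a]; last first.
    by rewrite /update map_rcons mem_rcons inE; case: (a == code c'); rewrite /= ?Vmem.
  rewrite size_rcons leq_eqVlt => /orP[/eqP->|i_rest] zL.
    by rewrite A'E //= nth_rcons ltnn eqxx c'E.
  rewrite A'mem // -rcons_cons nth_rcons /=.
  by rewrite i_rest.
- by exists c'; rewrite // mem_rcons mem_head.
Qed.

Lemma runs_expand rest h c acc x y full cd v kk hh A V S :
  good_queue rest -> queue_mem rest A V -> h <= size rest ->
  c = nth c0 (c0 :: rest) h ->
  (forall z, z < L -> (S (sy z) != 0) = started L sy (marks c) (sy z)) ->
  runs expand
    (St [:: acc; p; L; h * L; (size rest).+1 * L; x; y; (num_open plt Q c).+1;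
            full; cd; v; kk; hh] (Mem L sy A V S))
    (fun t s' => t <= L * (L * 150 + 160) + 20 /\
      exists x' y' cd' v' A' V' ext, let rest' := rest ++ ext in
      [/\ s' = St [:: acc; p; L; h * L; (size rest').+1 * L; x'; y';
                      (num_open plt Q c).+1; full; cd'; v'; kk; hh]
                  (Mem L sy A' V' S),
          good_queue rest', queue_mem rest' A' V'
        & num_open plt Q c < p -> expanded c rest' L]).
Proof.
move=> good Amem h_rest cE S_started.
apply: runs_if => /=; rewrite addn1 subSS subn_eq0 -ltnNge; case: ifP => cp; last first.
  apply: runs_skip; split; first by lia.
  by exists x, y, cd, v, A, V, [::]; rewrite cats0 cp.
pose J y rs m := exists x cd v A V ext, let rest' := rest ++ ext in [/\
  rs = [:: acc; p; L; h * L; (size rest').+1 * L; x; y; (num_open plt Q c).+1;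
           full; cd; v; kk; hh] /\ m = Mem L sy A V S,
  good_queue rest', queue_mem rest' A V & expanded c rest' y].
apply: runs_conseq (@runs_loop _ _ L (L * 150 + 140) _ _ J _ _ _).
- move=> t s' [tT [rs [m [-> [x' [cd' [v' [A' [V' [ext [[-> ->] *]]]]]]]]]]].
  by split; [lia | exists x', L, cd', v', A', V', ext].
- by move=> ? ? ? [? [? [? [? [? [? [[-> _] _ _ _]]]]]]].
- move=> z rs m zL [x' [cd' [v' [A' [V' [ext [[-> ->] good' mem' exp']]]]]]].
  have h_rest' : h <= size (rest ++ ext) by rewrite size_cat; lia.
  have cE' : c = nth c0 (c0 :: rest ++ ext) h by rewrite -cat_cons nth_cat ltnS h_rest.
  apply: runs_if; rewrite eval_sub !eval_arr //= subn1.
  have [Amem' _] := mem'; rewrite !Amem' -?cE' //; last by rewrite (leq_ltn_trans (leq_pred _)).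
  have -> : marks c z.-1 - marks c z != 0 = addable plt Q c z.
    by rewrite /addable zL; case: (marks c z.-1); case: (marks c z).
  case: ifP => zadd.
    apply: runs_conseq (runs_successor _ _ _ _ _ _ _ _ good' mem' h_rest' cE' zadd cp S_started).
    move=> t s' [tT [cd2 [v2 [A2 [V2 [ext2 [-> good2 mem2 ex2]]]]]]].
    split; first by move: tT => /=; lia.
    eexists; eexists; split; [reflexivity..|].
    rewrite -catA in good2 mem2 ex2 *.
    exists L, cd2, v2, A2, V2, (ext ++ ext2); split=> //.
    move=> y'; rewrite ltnS leq_eqVlt => /orP[/eqP->|y'z] //.
    by apply: sub_expanded exp' _ y'z => d dR; rewrite catA mem_cat dR.
  apply: runs_skip; split; first by lia.
  eexists; eexists; split; [reflexivity..|].
  exists x', cd', v', A', V', ext; split=> //.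
  by move=> y'; rewrite ltnS leq_eqVlt => /orP[/eqP->|]; [rewrite zadd | apply: exp'].
- by exists x, cd, v, A, V, [::]; rewrite cats0.
Qed.

Lemma runs_search x y cnt full cd v kk hh A V S :
  queue_mem [::] A V ->
  runs search
    (St [:: 0; p; L; 0; L; x; y; cnt; full; cd; v; kk; hh] (Mem L sy A V S))
    (fun t s' => t <= (decision_bound plt Q).+1 * (450 * (L + 1) ^ 2 + 10) + 10 /\
                 (accepting s' <-> fifo_stackup plt Q p)).
Proof.
move=> mem0; set K := decision_bound plt Q.
(* [h] rows have been processed. At most [K] configurations follow the initial one in the queue, so
   [K.+1] rounds suffice. *)
pose I i s := exists acc h rest x y cnt full cd v kk hh A V S,
  [/\ s = St [:: acc; p; L; h * L; (size rest).+1 * L; x; y; cnt; full; cd; v; kk; hh]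
             (Mem L sy A V S),
      i + h = K.+1 /\ h <= (size rest).+1, good_queue rest /\ queue_mem rest A V,
      (acc != 0) = (final Q \in take h (c0 :: rest))
    & forall j, j < h -> let c := nth c0 (c0 :: rest) j in
        num_open plt Q c < p -> expanded c rest L].
have L_gt0 : 0 < L by rewrite len_sum; lia.
have size_rest rest : good_queue rest -> size rest <= K.
  by case=> uR RP; apply: (size_decision valid) => // c /RP[].
have I0 : I K.+1 (St [:: 0; p; L; 0; L; x; y; cnt; full; cd; v; kk; hh]
                     (Mem L sy A V S)).
  exists 0, 0, [::], x, y, cnt, full, cd, v, kk, hh, A, V, S.
  by rewrite mul1n addn0; split=> //; do !split.
apply: runs_conseq (@runs_while _ _ I (450 * (L + 1) ^ 2) _ _ _ I0).
  move=> t s' [tT [i [acc [h [rest [x' [y' [cnt' [full' [cd' [v' [kk' [hh' [A' [V' [S'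
    [-> [ih h_rest] [good mem] accE expd]]]]]]]]]]]]]]] /= done]].
  split; first by move: tT => /=; lia.
  have {}h_rest : h = (size rest).+1.
    apply/eqP; rewrite eqn_leq h_rest -(leq_pmul2r L_gt0) /=.
    by move/eqP: done; rewrite subn_eq0.
  rewrite /accepting /= accE h_rest -[(size rest).+1]/(size (c0 :: rest)) take_size.
  apply: (reachable_final valid).
  - exact: mem_head.
  - by move=> c; apply: good_queue_mem.
  - move=> c u Rc uadd cp; have uL : u < L by case/and3P: uadd.
    have ih' : index c (c0 :: rest) < h by rewrite h_rest -index_mem in Rc *.
    have := expd _ ih'; rewrite nth_index // => /(_ cp u uL uadd)[c' Rc' c'E].
    by exists c' => //; rewrite inE Rc' orbT.
move=> i s [acc [h [rest [x1 [y1 [cnt1 [full1 [cd1 [v1 [kk1 [hh1 [A1 [V1 [S1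
    [-> [ih h_rest] [good mem] accE expd]]]]]]]]]]]]]]] /=.
rewrite subn_eq0 leq_pmul2r // -ltnNge ltnS => {}h_rest.
have sK := size_rest _ good.
split; first by lia.
pose c := nth c0 (c0 :: rest) h.
have cR : c \in c0 :: rest by rewrite mem_nth.
have [wfc _ _] := good_queue_mem good cR.
have headA z : z < L -> A1 (h * L + z) = marks c z by case: mem => Amem _ zL; rewrite Amem.
apply: runs_seq; apply: runs_conseq (runs_clear _ _ _ _ _ _ _ _ _ _ _ _ _ _ _ _ _).
move=> t2 s2 [t2T [S2 [-> S2E]]].
apply: runs_seq; apply: runs_conseq (runs_mark _ _ _ headA _ _ _ _ _ _ _ _ _ S2E).
move=> t3 s3 [t3T [S3 [-> S3E]]].
apply: runs_seq; apply: runs_conseq (runs_count_open _ _ _ headA _ _ _ _ _ _ _ _ _ S3E).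
move=> t4 s4 [t4T [S4 [-> S4E]]].
apply: runs_seq; apply: runs_set => /=; rewrite (size_open_syms valid).
apply: runs_seq.
apply: runs_conseq (runs_expand _ _ _ _ _ _ _ _ good mem h_rest erefl S4E).
move=> t5 s5 [t5T [x5 [y5 [cd5 [v5 [A5 [V5 [ext [-> good5 mem5 exp5]]]]]]]]].
apply: runs_set => /=; split.
  have -> : (L + 1) ^ 2 = L * L + 2 * L + 1 by rewrite sqrnD mulnn; lia.
  by move: t5T; rewrite mulnDr mulnA (mulnC (L * L)); lia.
exists (acc + all (marks c) (iota 0 L)), h.+1, (rest ++ ext), x5, y5.
eexists; eexists; exists cd5, v5, kk1, hh1, A5, V5, S4; split.
- have -> : h.+1 * L = h * L + L by rewrite mulSn addnC.
  reflexivity.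
- by split; [lia | rewrite size_cat; lia].
- by [].
- rewrite all_marks // -cat_cons takel_cat ?(ltnW h_rest) //.
  rewrite (take_nth c0) // mem_rcons inE -accE -/c [final Q == c]eq_sym.
  by case: (c == _); rewrite ?addn1 ?addn0.
- move=> j; rewrite ltnS leq_eqVlt -cat_cons => /orP[/eqP->|jh].
    by rewrite nth_cat /= ltnS h_rest.
  rewrite nth_cat /= ltnS (leq_trans (ltnW jh)) // => /(expd _ jh).
  by apply: sub_expanded => d dR; rewrite mem_cat dR.
Qed.

End Search.

Theorem theorem4 :
  exists (P : cmd) (C : nat),
  forall (B : eqType) (k : nat) (plt : B -> nat) (Q : k.-tuple (seq B))
         (p : nat),
    valid_instance plt Q p ->
    exists (t : nat) (s : state),
      [/\ exec P (load_input (encode plt Q p)) t s,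
          accepting s <-> fifo_stackup plt Q p
        & 0 < num_bins Q ->
          t <= C * (num_bins Q ^ 2 * (num_pallets plt Q + 2) ^ k)].
Proof.
(* 1200 is the machine cost per unit of [K * (L + 1) ^ 2], and 50 comes from [time_bound]. *)
exists stack_up, (50 * 1200) => B k plt Q p valid.
have -> : encode plt Q p = [:: size (symbol_seqs plt Q), p &
    flatten [seq size q :: q | q <- symbol_seqs plt Q]].
  rewrite /encode /symbol_seqs size_map size_tuple -map_comp.
  by congr [:: _, _ & flatten _]; apply: eq_map => q /=; rewrite size_map.
set L := len plt Q; set K := decision_bound plt Q.
have [t [s [cs [tT sE]]]] : runs stack_up
    (load_input [:: size (symbol_seqs plt Q), p &
       flatten [seq size q :: q | q <- symbol_seqs plt Q]])
    (fun t s => t <= 1200 * (K * (L + 1) ^ 2) /\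
                (accepting s <-> fifo_stackup plt Q p)).
  apply: runs_seq; apply: runs_conseq (runs_scan _ _) => t1 s1 [t1T [h ->]].
  apply: runs_seq; apply: runs_conseq (runs_init_queue _ _ _) => t2 s2 [t2T [A [-> AE]]].
  apply: runs_conseq (runs_search valid _ _ _ _ _ _ _ _ _ _); last first.
    split=> // i x; rewrite leqn0 => /eqP-> xL /=.
    by rewrite mul0n add0n AE // (marks_initial valid).
  move=> t3 s3 [t3T s3E]; split=> //.
  (* Since [K] is positive, [K * (L + 1) ^ 2] absorbs the linear cost of scanning and initialization
     and the extra round of the search. *)
  have K_gt0 : 0 < K by rewrite /K /decision_bound; apply: prodn_gt0.
  have kL : size (symbol_seqs plt Q) <= L by rewrite size_map size_tuple /L len_sum; lia.
  move: t1T t2T t3T; rewrite -/L -[size (symbols _)]/L -/K => t1T t2T t3T.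
  have LL : L + 1 <= (L + 1) ^ 2 by rewrite -mulnn leq_pmulr // addn1.
  have KL : (L + 1) ^ 2 <= K * (L + 1) ^ 2 by rewrite leq_pmull.
  have KK : K <= K * (L + 1) ^ 2 by rewrite leq_pmulr // expn_gt0 addn1.
  move: t3T LL KL KK; move: ((L + 1) ^ 2) => b.
  rewrite mulSn mulnDr (mulnCA K).
  move: (K * b) => a; lia.
exists t, s; split=> // n0; apply: leq_trans tT _.
by rewrite [50 * _]mulnC -mulnA leq_mul2l (time_bound plt n0).
Qed.
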